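(* Let $p>2$ be a prime number. Then there are infinitely many non finitely generated clones on $\mathbb{Z}_p\times\mathbb{Z}_p$ which contain the (componentwise) addition $+$ of $\mathbb{Z}_p\times\mathbb{Z}_p$.
   Context: A clone on a set $A$ is a set of finitary operations on $A$ (of arities $n\ge 1$) that contains all projections and is closed under composition, i.e. $f(g_1,\dots,g_n)\in C$ whenever $f\in C$ is $n$-ary and $g_1,\dots,g_n\in C$ are all $m$-ary. A clone is finitely generated if it is the smallest clone containing some finite set of operations. *)

(* Defs.v *)
From mathcomp Require Import all_boot all_algebra.
From mathcomp Require Import classical_sets cardinality.

Set Implicit Arguments.
Unset Strict Implicit.
Unset Printing Implicit Defensive.

Import GRing.Theory.
Local Open Scope classical_set_scope.

(* Arities are at least 1, so the index n stands for the arity n.+1. *)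
Definition op (A : Type) (n : nat) : Type := ('I_n.+1 -> A) -> A.

Definition operation (A : Type) : Type := {n : nat & op A n}.

Definition Op (A : Type) (n : nat) (f : op A n) : operation A :=
  existT (op A) n f.

Definition proj_op (A : Type) (n : nat) (i : 'I_n.+1) : op A n :=
  fun x => x i.

Definition comp_op (A : Type) (n m : nat) (f : op A n)
    (g : 'I_n.+1 -> op A m) : op A m :=
  fun x => f (fun i => g i x).

Definition is_clone (A : Type) (C : set (operation A)) : Prop :=
  (forall (n : nat) (i : 'I_n.+1), C (Op (@proj_op A n i))) /\
  (forall (n m : nat) (f : op A n) (g : 'I_n.+1 -> op A m),
     C (Op f) -> (forall i, C (Op (g i))) -> C (Op (comp_op f g))).

Definition finitely_generated (A : Type) (C : set (operation A)) : Prop :=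
  exists F : set (operation A),
    finite_set F /\ C = smallest (@is_clone A) F.

Definition add_op (V : zmodType) : op V 1 :=
  fun x => (x ord0 + x ord_max)%R.

(* Main.v *)
Require Import Defs.
From mathcomp Require Import all_boot all_algebra.
From mathcomp Require Import boolp classical_sets cardinality functions.

(** Write an argument tuple over [R * R] as a pair [(x, y)] of tuples over [R],
    and consider the operations

      [(x, y) |-> (l . x, l . y + g x)],

    with [l] a coefficient vector and [g] a function of the first coordinates
    alone.  Composing such operations adds up multiples of the perturbations
    [g] and substitutes linear maps into them.  Hence every family [G] of
    functions that is stable under sums, scalar multiples and linear
    substitutions gives a clone containing the addition
    ([is_clone_perturbed]), and different families give different clones
    ([perturbed_cloneE]).

    Linear substitutions respect the total degree, and they respect the
    splitting of a function into its even and odd parts.  So take for [G] the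
    functions of finite degree whose odd part has degree less than [k], with
    no common bound on the degree of the even part.

    - The resulting clone is not finitely generated: a finite set of generators
      has perturbations of degree less than some [N], all that it generates
      then has the same property, but the product of an even number of
      variables is an even function and may have any number of factors
      ([not_finitely_generated_odd_bounded]).
    - These clones are infinitely many: the product of an odd number [m] of
      variables is an odd function of degree [m], and since [2] is nonzero in
      [R] its odd part does not vanish, so it is allowed as a perturbation
      exactly when [m < k] ([monomial_op_odd_bounded]).

    The argument works over every commutative ring [R] in which [2] is nonzero.
    As distinct formal polynomials may define the same function, the degree is
    that of functions, measured by the number of finite differences needed to
    annihilate them.  The product of [m] distinct variables then has degree
    exactly [m] ([deg_lt_monomial], [deg_lt_size_monomial]). *)

Set Implicit Arguments.
Unset Strict Implicit.
Unset Printing Implicit Defensive.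

Import GRing.Theory.
Local Open Scope classical_set_scope.

(** * Unions of increasing sequences of clones *)

Section ClonesUnion.

Variables (A : Type) (B : nat -> set (operation A)).
Hypothesis B_clone : forall N, is_clone (B N).
Hypothesis B_incr : forall M N, (M <= N)%N -> B M `<=` B N.

(** A composition only involves finitely many operations, hence takes place
    in a single member of the sequence. *)
Lemma is_clone_bigcup_incr : is_clone (\bigcup_N B N).
Proof.
split=> [n i|n m f g [M _ Bf] Bg]; first by exists 0%N => //; apply: (B_clone 0).1.
have /fin_all_exists [N BNg] : forall i, exists N, B N (Op (g i)).
  by move=> i; case: (Bg i) => N _ BN; exists N.
exists (M + \max_i N i)%N => //; apply: (B_clone _).2.
  by apply: B_incr Bf; apply: leq_addr.
move=> i; apply: B_incr (BNg i).
by apply: leq_trans (leq_addl _ _); apply: leq_bigmax.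
Qed.

(** Finitely many generators lie in a single member of the sequence, which is
    a clone and therefore contains all that they generate. *)
Lemma not_finitely_generated_bigcup_incr :
  (forall N, ~ (\bigcup_N B N `<=` B N)) -> ~ finitely_generated (\bigcup_N B N).
Proof.
move=> B_proper [F [finF BE]].
have : forall f, exists N, F f -> B N f.
  move=> f; have [Ff|nFf] := pselect (F f); last by exists 0%N.
  have [N _ BNf] : (\bigcup_N B N) f by rewrite BE; apply: sub_gen_smallest Ff.
  by exists N.
move=> /choice [rank BF].
have /finite_seqP [s Fs] : finite_set (rank @` F) by apply: finite_image.
apply: (B_proper (\max_(k <- s) k)%N); rewrite {1}BE.
apply: smallest_sub => // f Ff; apply: B_incr (BF f Ff).
apply: (@leq_bigmax_seq _ s xpredT id) => //.
have : (rank @` F) (rank f) by exists f.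
by rewrite Fs.
Qed.

End ClonesUnion.

(** * Degree by finite differences *)

Section PerturbedLinearOperations.

Local Open Scope ring_scope.

Variables (R : comNzRingType).

Section OneDomain.

Variable V : zmodType.
Implicit Types (g : V -> R) (h : V).

Definition diff h g : V -> R := fun x => g (x + h) - g x.

(** The degree of a function as seen by finite differences.  The recursion
    never mentions coordinates, which makes the notion stable under additive
    substitutions. *)
Fixpoint deg_lt (k : nat) g : Prop :=
  if k is k'.+1 then forall h, deg_lt k' (diff h g) else forall x, g x = 0.

(** Twice the odd part; it is defined without division by [2]. *)
Definition odd_diff g : V -> R := fun x => g x - g (- x).

Lemma deg_lt_zero k : deg_lt k (fun _ => 0).
Proof.
elim: k => [|k IH] //= h.
by rewrite (_ : diff _ _ = fun=> 0) //; apply/funext => x; rewrite /diff subrr.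
Qed.

Lemma deg_ltD k g1 g2 :
  deg_lt k g1 -> deg_lt k g2 -> deg_lt k (fun x => g1 x + g2 x).
Proof.
elim: k g1 g2 => [|k IH] g1 g2 /= d1 d2 => [x|h]; first by rewrite d1 d2 addr0.
rewrite (_ : diff _ _ = fun x => diff h g1 x + diff h g2 x); first exact: IH.
by apply/funext => x; rewrite /diff opprD addrACA.
Qed.

Lemma deg_ltZ k c g : deg_lt k g -> deg_lt k (fun x => c * g x).
Proof.
elim: k g => [|k IH] g /= d => [x|h]; first by rewrite d mulr0.
rewrite (_ : diff _ _ = fun x => c * diff h g x); first exact: IH.
by apply/funext => x; rewrite /diff mulrBr.
Qed.

Lemma deg_lt_shift k h g : deg_lt k g -> deg_lt k (fun x => g (x + h)).
Proof.
elim: k g => [|k IH] g /= d => [x|h']; first exact: d.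
rewrite (_ : diff _ _ = fun x => diff h' g (x + h)); first exact: IH.
by apply/funext => x; rewrite /diff addrAC.
Qed.

Lemma deg_lt_leq k l g : (k <= l)%N -> deg_lt k g -> deg_lt l g.
Proof.
elim: k l g => [|k IH] [|l] g //= kl d; last by move=> h; apply: IH (d h).
have -> : g = fun=> 0 by apply/funext.
exact: (deg_lt_zero l.+1).
Qed.

(** The discrete Leibniz rule
    [diff h (l * g) x = l x * diff h g x + l h * g (x + h)]. *)
Lemma deg_lt_mul_additive k (l : V -> R) g :
  {morph l : x y / x + y} -> deg_lt k g -> deg_lt k.+1 (fun x => l x * g x).
Proof.
move=> lD.
have leibniz g' h :
    diff h (fun x => l x * g' x) = fun x => l x * diff h g' x + l h * g' (x + h).
  by apply/funext => x; rewrite /diff lD mulrDl mulrBr addrAC.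
elim: k g => [|k IH] g d h; rewrite leibniz.
  by move=> x; rewrite /diff !d subrr !mulr0 addr0.
apply: (@deg_ltD k.+1); first exact: IH.
by apply: (@deg_ltZ k.+1); apply: (@deg_lt_shift k.+1).
Qed.

(** Differencing in a direction [h] along which only the factor [l] varies
    strips off that factor. *)
Lemma deg_lt_strip_factor k h (l g : V -> R) :
    {morph l : x y / x + y} -> l h = 1 -> (forall x, g (x + h) = g x) ->
  deg_lt k.+1 (fun x => l x * g x) -> deg_lt k g.
Proof.
move=> lD lh gh /(_ h); rewrite (_ : diff _ _ = g) //.
by apply/funext => x; rewrite /diff gh -mulrBl lD addrAC subrr add0r lh mul1r.
Qed.

End OneDomain.

Lemma deg_lt_comp (V W : zmodType) (L : V -> W) k (g : W -> R) :
  {morph L : x y / x + y} -> deg_lt k g -> deg_lt k (fun x => g (L x)).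
Proof.
move=> LD; elim: k g => [|k IH] g /= d => [x|h]; first exact: d.
rewrite (_ : diff _ _ = fun x => diff (L h) g (L x)); first exact: IH.
by apply/funext => x; rewrite /diff LD.
Qed.

Section Monomial.

Variable I : eqType.

Definition monomial (s : seq I) : (I -> R) -> R := fun x => \prod_(i <- s) x i.

(** Each variable is an additive map and so raises the degree by at most one;
    the empty product is a constant. *)
Lemma deg_lt_monomial s : deg_lt (size s).+1 (monomial s).
Proof.
elim: s => [|i s IH].
  by move=> h x; rewrite /diff /monomial !big_nil subrr.
rewrite (_ : monomial _ = fun x => x i * monomial s x).
  exact: (deg_lt_mul_additive (l := fun x => x i)).
by apply/funext => x; rewrite /monomial big_cons.
Qed.

(** Differencing along the coordinate vectors of [s] one after the other
    removes all variables and leaves the constant [c]. *)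
Lemma deg_lt_size_monomial s c :
  uniq s -> deg_lt (size s) (fun x => c * monomial s x) -> c = 0.
Proof.
elim: s => [|i s IH] /=; first by move=> _ /(_ 0); rewrite /monomial big_nil mulr1.
move=> /andP[is_ us] d; apply: IH => //.
pose e : I -> R := fun j => (j == i)%:R.
apply: (@deg_lt_strip_factor _ _ e (fun x => x i)) => //.
- by rewrite /e eqxx.
- move=> x; rewrite /monomial; congr (_ * _); apply: eq_big_seq => j js.
  rewrite [LHS](_ : _ = x j + e j) // /e; case: eqP js => [->|_ _].
    by rewrite (negPf is_).
  by rewrite addr0.
move: d; rewrite [X in @deg_lt _ (size s).+1 X -> _](_ : _ = fun x => x i * (c * monomial s x)) //.
by apply/funext => x; rewrite /monomial big_cons mulrCA.
Qed.

Lemma odd_diff_monomial s :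
  odd_diff (monomial s) = fun x => (1 - (-1) ^+ size s) * monomial s x.
Proof.
apply/funext => x; rewrite /odd_diff mulrBl mul1r; congr (_ - _).
elim: s => [|i s IH]; first by rewrite /monomial !big_nil mulr1.
rewrite /monomial !big_cons /= -/(monomial s _) IH exprS.
rewrite [X in X * _](_ : _ = - x i) //.
by rewrite [RHS]mulrACA mulN1r.
Qed.

End Monomial.

(** * Clones of linear maps with a perturbation of the second coordinate *)

Definition lin_map n m (L : 'I_m -> 'I_n -> R) (x : 'I_n -> R) : 'I_m -> R :=
  fun j => \sum_i L j i * x i.

Lemma lin_mapD n m (L : 'I_m -> 'I_n -> R) : {morph lin_map L : x y / x + y}.
Proof.
move=> x y; apply/funext => j; rewrite [RHS](_ : _ = lin_map L x j + lin_map L y j) //.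
by rewrite /lin_map -big_split; apply: eq_bigr => i _; exact: mulrDr.
Qed.

Definition perturbed_op n (l : 'I_n.+1 -> R) (g : ('I_n.+1 -> R) -> R) :
    op (R * R)%type n :=
  fun x => (\sum_i l i * (x i).1, \sum_i l i * (x i).2 + g (fun i => (x i).1)).

Definition perturbed_clone (G : forall n, set (('I_n.+1 -> R) -> R)) :
    set (operation (R * R)%type) :=
  fun f => exists l g, projT2 f = perturbed_op l g /\ G (projT1 f) g.

Definition linearly_closed (G : forall n, set (('I_n.+1 -> R) -> R)) : Prop :=
  [/\ forall n, G n (fun _ => 0),
      forall n g1 g2, G n g1 -> G n g2 -> G n (fun x => g1 x + g2 x),
      forall n c g, G n g -> G n (fun x => c * g x)
    & forall n m (L : 'I_m.+1 -> 'I_n.+1 -> R) g,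
        G m g -> G n (fun x => g (lin_map L x))].

Lemma linearly_closed_sum G n (I : Type) (s : seq I) (c : I -> R)
    (h : I -> ('I_n.+1 -> R) -> R) :
  linearly_closed G -> (forall i, G n (h i)) ->
  G n (fun x => \sum_(i <- s) c i * h i x).
Proof.
move=> [G0 GD GZ _] Gh; elim: s => [|i s IH].
  by under eq_fun do rewrite big_nil; exact: G0.
under eq_fun do rewrite big_cons.
by apply: GD IH; apply: GZ.
Qed.

(** Substituting into [perturbed_op l g] operations with perturbations [h i]
    gives the perturbation [\sum_i l i * h i + g \o L], where [L] collects the
    linear parts of the inner operations. *)
Lemma is_clone_perturbed G : linearly_closed G -> is_clone (perturbed_clone G).
Proof.
move=> G_lin; have [G0 GD GZ GL] := G_lin; split.
  move=> n i; exists (fun j => (j == i)%:R), (fun=> 0); split=> //=.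
  apply/funext => x; rewrite /perturbed_op /proj_op addr0.
  have pick (y : 'I_n.+1 -> R) : \sum_j (j == i)%:R * y j = y i.
    rewrite (bigD1 i) //= eqxx mul1r big1 ?addr0 // => j /negPf ->.
    by rewrite mul0r.
  by rewrite !pick; case: (x i).
move=> n m f g [l [u [/= -> Gu]]] Gg.
have /fin_all_exists [L /fin_all_exists [h gLh]] : forall i, exists L h,
    g i = perturbed_op L h /\ G m h by move=> i; exact: Gg.
exists (fun j => \sum_i l i * L i j), (fun x => \sum_i l i * h i x + u (lin_map L x)).
have comb (y : 'I_m.+1 -> R) :
    \sum_i l i * lin_map L y i = \sum_j (\sum_i l i * L i j) * y j.
  under eq_bigr do rewrite mulr_sumr.
  rewrite exchange_big /=; apply: eq_bigr => j _; rewrite mulr_suml.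
  by apply: eq_bigr => i _; rewrite mulrA.
split => /=.
  apply/funext => x; rewrite /comp_op {1}/perturbed_op /=.
  under eq_bigr => i _ do rewrite (gLh i).1 /=.
  under [X in (_, X + _)]eq_bigr => i _ do rewrite (gLh i).1 /= mulrDr.
  have /= comb1 := comb (fun j => (x j).1); have /= comb2 := comb (fun j => (x j).2).
  rewrite big_split [RHS]/perturbed_op -comb1 -comb2 addrA.
  congr (_, _ + u _).
  by apply/funext => i; rewrite (gLh i).1.
apply: GD; last exact: GL.
by apply: linearly_closed_sum => // i; exact: (gLh i).2.
Qed.

(** Setting all second coordinates to [0] recovers the perturbation from the
    operation, so it does not depend on the chosen linear part. *)
Lemma perturbed_cloneE (G : forall n, set (('I_n.+1 -> R) -> R)) n g :
  perturbed_clone G (Op (@perturbed_op n (fun _ => 0) g)) <-> G n g.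
Proof.
split=> [[l [g' [/= fE Gg']]]|Gg]; last by exists (fun=> 0), g.
suff -> : g = g' by [].
apply/funext => x; move/(congr1 (fun f => (f (fun i => (x i, 0))).2)): fE => /=.
by rewrite !big1 ?add0r // => i _; rewrite mulr0.
Qed.

Lemma perturbed_clone_add G : linearly_closed G ->
  perturbed_clone G (Op (@add_op (R * R)%type)).
Proof.
move=> [G0 _ _ _]; exists (fun=> 1), (fun=> 0); split=> //=.
apply/funext => x; rewrite /add_op /perturbed_op /= !big_ord_recl !big_ord0.
rewrite !mul1r !addr0 (_ : lift _ _ = ord_max) //; exact: val_inj.
Qed.

(** * Perturbations whose odd part has bounded degree *)

Definition bounded_odd (k N : nat) n : set (('I_n.+1 -> R) -> R) :=
  fun g => deg_lt N g /\ deg_lt k (odd_diff g).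

Lemma linearly_closed_bounded_odd k N : linearly_closed (@bounded_odd k N).
Proof.
split.
- move=> n; split; first exact: deg_lt_zero.
  rewrite (_ : odd_diff _ = fun=> 0); first exact: deg_lt_zero.
  by apply/funext => x; rewrite /odd_diff subrr.
- move=> n g1 g2 [d1 o1] [d2 o2]; split; first exact: deg_ltD.
  rewrite (_ : odd_diff _ = fun x => odd_diff g1 x + odd_diff g2 x).
    exact: deg_ltD.
  by apply/funext => x; rewrite /odd_diff opprD addrACA.
- move=> n c g [d o]; split; first exact: deg_ltZ.
  rewrite (_ : odd_diff _ = fun x => c * odd_diff g x); first exact: deg_ltZ.
  by apply/funext => x; rewrite /odd_diff mulrBr.
move=> n m L g [d o]; split; first exact: (deg_lt_comp (@lin_mapD _ _ L)).
rewrite (_ : odd_diff _ = fun x => odd_diff g (lin_map L x)).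
  exact: (deg_lt_comp (@lin_mapD _ _ L)).
apply/funext => x; rewrite /odd_diff; congr (_ - g _).
apply/funext => j; rewrite [RHS](_ : _ = - lin_map L x j) // -sumrN.
by apply: eq_bigr => i _; rewrite -mulrN.
Qed.

Lemma bounded_odd_incr k M N : (M <= N)%N ->
  perturbed_clone (@bounded_odd k M) `<=` perturbed_clone (@bounded_odd k N).
Proof.
move=> MN f [a [g [fE [d o]]]]; exists a, g; split=> //.
by split=> //; apply: deg_lt_leq d.
Qed.

(** The union over [N] leaves the degree of the even part unbounded, while each
    single perturbation still has a finite degree. *)
Definition odd_bounded_clone (k : nat) : set (operation (R * R)%type) :=
  \bigcup_N perturbed_clone (@bounded_odd k N).

Lemma is_clone_odd_bounded k : is_clone (odd_bounded_clone k).
Proof.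
apply: is_clone_bigcup_incr => [N|M N].
  exact/is_clone_perturbed/linearly_closed_bounded_odd.
exact: bounded_odd_incr.
Qed.

Lemma odd_bounded_clone_add k :
  odd_bounded_clone k (Op (@add_op (R * R)%type)).
Proof.
by exists 0%N => //; apply/perturbed_clone_add/linearly_closed_bounded_odd.
Qed.

Definition monomial_op n : op (R * R)%type n :=
  perturbed_op (fun _ => 0) (monomial (enum 'I_n.+1)).

(** Products of an even number of variables have zero odd part, so all of them
    belong to the clone; but each member of the union bounds the degree and
    thus misses the products of many variables. *)
Lemma not_finitely_generated_odd_bounded k :
  ~ finitely_generated (odd_bounded_clone k).
Proof.
apply: not_finitely_generated_bigcup_incr => [N|M N|N].
- exact/is_clone_perturbed/linearly_closed_bounded_odd.
- exact: bounded_odd_incr.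
move=> sub.
(* The index [N.*2.+1] stands for the arity [N.*2.+2], which is even and at
   least [N]. *)
have /perturbed_cloneE [d _] :
    perturbed_clone (@bounded_odd k N) (Op (@monomial_op N.*2.+1)).
  apply: sub; exists (size (enum 'I_N.*2.+2)).+1 => //; apply/perturbed_cloneE.
  split; first exact: deg_lt_monomial.
  rewrite odd_diff_monomial size_enum_ord.
  rewrite (_ : (fun x => _) = fun=> 0); first exact: deg_lt_zero.
  by apply/funext => x; rewrite -signr_odd /= odd_double subrr mul0r.
have : deg_lt (size (enum 'I_N.*2.+2)) (monomial (enum 'I_N.*2.+2)).
  by apply: deg_lt_leq d; rewrite size_enum_ord -addnn -addn2 -addnA leq_addr.
rewrite (_ : monomial _ = fun x => 1 * monomial (enum 'I_N.*2.+2) x).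
  by move/(deg_lt_size_monomial (enum_uniq _))/eqP; rewrite oner_eq0.
by apply/funext => x; rewrite mul1r.
Qed.

(** The monomial is the product of [j.*2.+1] variables; it is odd, so its
    [odd_diff] is twice the monomial itself. *)
Lemma monomial_op_odd_bounded k j : 2%:R != 0 :> R ->
  odd_bounded_clone k (Op (@monomial_op j.*2)) <-> (j.*2.+2 <= k)%N.
Proof.
move=> two_neq0; set s := enum 'I_j.*2.+1.
have oddE : odd_diff (monomial s) = fun x => 2%:R * monomial s x.
  rewrite odd_diff_monomial size_enum_ord.
  by apply/funext => x; rewrite -signr_odd /= odd_double opprK -mulr2n.
rewrite /monomial_op; split=> [[N _ /perturbed_cloneE [_]]|jk].
  rewrite leqNgt oddE ltnS => o; apply/negP => kj; move/eqP: two_neq0; apply.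
  apply: (@deg_lt_size_monomial _ s) (enum_uniq _) _.
  by apply: deg_lt_leq o; rewrite size_enum_ord.
have ds := deg_lt_monomial s.
exists (size s).+1 => //; apply/perturbed_cloneE; split=> //.
rewrite oddE; apply: deg_lt_leq (deg_ltZ _ ds).
by rewrite size_enum_ord.
Qed.

(** Only even bounds are used: these are the ones that products of an odd number
    of variables tell apart. *)
Lemma odd_bounded_clone_inj : 2%:R != 0 :> R ->
  injective (fun j => odd_bounded_clone j.*2).
Proof.
move=> two_neq0 i j eqij.
have mem k := monomial_op_odd_bounded _ k two_neq0.
(* For [0 < i'], the clone of [i'] contains the product of [i'.*2.-1]
   variables, which forces [i' <= j']. *)
suff le i' j' : odd_bounded_clone i'.*2 = odd_bounded_clone j'.*2 -> (i' <= j')%N.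
  by apply/eqP; rewrite eqn_leq !le.
case: i' => // i' E; have : odd_bounded_clone (i'.+1).*2 (Op (@monomial_op i'.*2)).
  exact/mem.
by rewrite E => /mem; rewrite -doubleS leq_double.
Qed.

End PerturbedLinearOperations.

Theorem theorem1p4 (p : nat) (p_prime : prime p) (p_gt2 : 2 < p) :
  infinite_set [set C : set (operation ('Z_p * 'Z_p)%type) |
    is_clone C /\ ~ finitely_generated C /\
    C (Op (@add_op ('Z_p * 'Z_p)%type))].
Proof.
have two_neq0 : (2%:R != 0 :> 'Z_p)%R.
  apply/eqP => /(congr1 (@nat_of_ord _)).
  by rewrite val_Zp_nat ?(ltnW p_gt2) // modn_small.
have clonesI := odd_bounded_clone_inj two_neq0.
apply: (@sub_infinite_set _ (range (fun j => @odd_bounded_clone 'Z_p j.*2))).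
  move=> _ [j _ <-]; split; first exact: is_clone_odd_bounded.
  split; first exact: not_finitely_generated_odd_bounded.
  exact: odd_bounded_clone_add.
apply/infiniteP; suff : (range (fun j => @odd_bounded_clone 'Z_p j.*2) #= [set: nat])%card.
  by rewrite card_eq_le => /andP[].
by apply: inj_card_eq => i j _ _; exact: clonesI.
Qed.
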